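(* There is a deterministic algorithm in the synchronous multi-port message-passing model with authenticated Byzantine faults that, for all $n$ and $t$ with $t<\frac n2$, solves consensus with up to $t$ Byzantine nodes in $\mathcal{O}(t)$ rounds, with the non-faulty nodes sending $\mathcal{O}(t^2+n)$ messages in total.
   Context: Model: $n$ nodes with distinct names in $\{1,\dots,n\}$; $n$ and $t$ are known to all nodes. Computation proceeds in synchronous rounds starting simultaneously; in a round any node may send messages to any set of other nodes, and all messages sent in a round are delivered in that round. Up to $t$ nodes may be faulty in the authenticated Byzantine sense: they may behave arbitrarily, but messages are authenticated (signed), so a faulty node cannot forge a message claiming it originates from, or is forwarded from, another node. Consensus: each node has an input value; every non-faulty node must eventually decide and halt, all non-faulty nodes decide on the same value, and the decided value is the input value of some node. Running time is the number of rounds until all non-faulty nodes halt; communication counts only messages sent by non-faulty nodes.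
   Formalization: With three or more possible values, the decided value is the input of a non-faulty node or a value signed by a faulty node as its input (using a faulty node's nominal input is unattainable); with at most two values it is literally some node's input. O(t) rounds is read as O(t+1), needed for t = 0. *)

(* Defs.v *)
From mathcomp Require Import all_boot.

Set Implicit Arguments.
Unset Strict Implicit.
Unset Printing Implicit Defensive.

(* Symbolic model of authentication: messages are terms, and [Sig k m] is the
   term m carrying the signature of node k.  Nodes are named by 'I_n, and V is
   the domain of input values. *)
Inductive msg (V : eqType) (n : nat) : Type :=
| Val of V
| Num of nat
| Pair of msg V n & msg V n
| Sig of 'I_n & msg V n.

Arguments Val {V n}.
Arguments Num {V n}.

Fixpoint subterm (V : eqType) n (s m : msg V n) : Prop :=
  s = m \/
  match m with
  | Val _ | Num _ => False
  | Pair m1 m2 => subterm s m1 \/ subterm s m2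
  | Sig _ m1 => subterm s m1
  end.

(* As an outbox it is indexed by receivers, as an inbox by (true) senders;
   [None] means no message on that link. *)
Definition ports (V : eqType) (n : nat) := {ffun 'I_n -> option (msg V n)}.

(* Inboxes of the rounds completed so far, oldest first. *)
Definition history (V : eqType) (n : nat) := seq (ports V n).

(* [Halt v] decides on v and stops. *)
Inductive action (V : eqType) (n : nat) : Type :=
| Halt of V
| Send of ports V n.

Arguments Halt {V n}.

Definition is_halt (V : eqType) n (a : action V n) : bool :=
  if a is Halt _ then true else false.

(* The action in the next round is a function of all that a node can know: its
   name, its input, and the messages it has received. *)
Definition protocol (V : eqType) (n : nat) :=
  'I_n -> V -> history V n -> action V n.

(* Running the protocol never requires a node to produce a signature of another
   node which it has not received before. *)
Definition respects_signatures (V : eqType) n (P : protocol V n) : Prop :=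
  forall (i : 'I_n) (a : V) (h : history V n) (out : ports V n)
         (j : 'I_n) (m : msg V n) (k : 'I_n) (x : msg V n),
    P i a h = Send out -> out j = Some m -> subterm (Sig k x) m ->
    k = i \/
    exists (r : nat) (l : 'I_n) (m' : msg V n),
      nth [ffun=> None] h r l = Some m' /\ subterm (Sig k x) m'.

(* [tr r i j] is the message sent by i and delivered to j in round r; rounds
   are numbered from 0. *)
Definition traffic (V : eqType) (n : nat) :=
  nat -> 'I_n -> 'I_n -> option (msg V n).

Definition local_history (V : eqType) n (tr : traffic V n) (i : 'I_n) (r : nat) :
    history V n :=
  [seq [ffun j => tr s j i] | s <- iota 0 r].

Definition at_most_two_values (V : eqType) : Prop :=
  forall x y z : V, [|| x == y, x == z | y == z].

Section Execution.
Variables (V : eqType) (n : nat) (P : protocol V n) (inp : 'I_n -> V).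
Variables (B : {set 'I_n}) (tr : traffic V n).

Definition next_action (i : 'I_n) (r : nat) : action V n :=
  P i (inp i) (local_history tr i r).

Definition halted (i : 'I_n) (r : nat) : bool :=
  has (fun s => is_halt (next_action i s)) (iota 0 r.+1).

Definition prescribed (r : nat) (i j : 'I_n) : option (msg V n) :=
  if (j == i) || halted i r then None
  else if next_action i r is Send out then out j else None.

(* B is the set of faulty nodes.  They collude: they can sign for one another
   and they share what they have received; but a signature of a non-faulty node
   can only be used by them after it has been delivered to one of them in an
   earlier round. *)
Definition execution : Prop :=
  [/\ forall r i, tr r i i = None,
      forall r i j, i \notin B -> tr r i j = prescribed r i j
    & forall r i j m k x,
        i \in B -> tr r i j = Some m -> subterm (Sig k x) m ->
        k \in B \/
        exists s l b m',
          [/\ (s < r)%N, b \in B, tr s l b = Some m' & subterm (Sig k x) m']].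

(* Node i executes rounds 0, ..., r - 1 and then halts with decision v. *)
Definition halts_at (i : 'I_n) (r : nat) (v : V) : Prop :=
  next_action i r = Halt v /\ forall s, (s < r)%N -> ~~ is_halt (next_action i s).

Definition decides (i : 'I_n) (v : V) : Prop := exists r, halts_at i r v.

Definition termination : Prop :=
  forall i, i \notin B -> exists v, decides i v.

Definition agreement : Prop :=
  forall i j v w, i \notin B -> j \notin B -> decides i v -> decides j w -> v = w.

(* A faulty node may act throughout as a correct node with another input would
   act, and may claim different inputs to different nodes; its claims are the
   values appearing under its signature. *)
Definition claimed_input (k : 'I_n) (v : V) : Prop :=
  if k \in B then
    exists r i j m, tr r i j = Some m /\ subterm (Sig k (Val v)) m
  else inp k = v.

(* The decided value is the input of some node.  For at most two possible values
   this refers to the inputs [inp] given to the nodes, faulty ones included.  For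
   three or more values that is unattainable: take n = 3, t = 1, inputs x, y, z
   and no faults; the node whose input is decided on could as well be a faulty
   one, given an input of another node but acting on the decided value.  Then the
   input of a faulty node is what it claims it to be. *)
Definition validity : Prop :=
  forall i v, i \notin B -> decides i v ->
    (at_most_two_values V -> exists k, inp k = v) /\
    (exists k, claimed_input k v).

Definition consensus : Prop := [/\ termination, agreement & validity].

Definition time_at_most (T : nat) : Prop :=
  forall i r v, i \notin B -> halts_at i r v -> (r <= T)%N.

(* Messages sent by non-faulty nodes in the first R rounds. *)
Definition messages (R : nat) : nat :=
  \sum_(r < R) \sum_(i in ~: B) \sum_(j < n) isSome (tr r i j).

Definition messages_at_most (M : nat) : Prop :=
  forall R, (messages R <= M)%N.

End Execution.

(* Main.v *)
Require Import Defs.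
From mathcomp Require Import all_boot zify.

Set Implicit Arguments.
Unset Strict Implicit.
Unset Printing Implicit Defensive.

(* The nodes [0, ..., 2t] form a committee whose members sign votes [(l, v)];
   [t.+1] votes for the same [(l, v)] are a certificate of level [l], and the
   signed inputs are the votes of level 0.  Nodes always send all they know, so
   any certificate is passed on whole.  In phase [l = 1, ..., t.+1] node [l.-1]
   leads: it collects the knowledge of the committee, proposes the value with the
   highest certificate it has seen, and spreads the certificate made of the votes
   for it.  A member votes only if the knowledge of the leader contains a
   certificate at least as high as its own.  Hence after the phase of the first
   correct leader all correct members hold a certificate that is the only one of
   its level, and every later correct vote is for the same value.  If all correct
   inputs equal [v], then certificates exist for [v] only.  A phase costs [O(t)]
   messages, because only the leader talks to the committee.

   The members then sign the outcome.  The other nodes are split into chains of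
   length [t.+1], along which the certificate of the outcome is passed; a node
   that does not get it from its predecessor asks the whole committee.  Only the
   heads of chains and successors of faulty nodes ask, so at most
   [n / (t + 1) + 1 + t] correct nodes do. *)

(** * Signed facts *)

Section Facts.
Variables (V : eqType) (n : nat).

(* [(k, l, v)] is the vote of [k] for [v] at level [l]; level 0 is the input
   of [k], the shape that [claimed_input] looks for. *)
Definition fact : Type := ('I_n * nat * V)%type.

Definition enc_fact (f : fact) : msg V n :=
  Sig f.1.1 (if f.1.2 is l.+1 then Pair (Defs.Num l) (Val f.2) else Val f.2).

Definition enc (K : seq fact) : msg V n :=
  foldr (fun f m => Pair (enc_fact f) m) (Defs.Num 0) K.

(** Defined on all terms, since faulty nodes may send anything; terms of another shape decode to
    nothing. *)
Fixpoint dec (m : msg V n) : seq fact :=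
  match m with
  | Pair m1 m2 => dec m1 ++ dec m2
  | Sig k (Val v) => [:: (k, 0, v)]
  | Sig k (Pair (Defs.Num l) (Val v)) => [:: (k, l.+1, v)]
  | _ => [::]
  end.

Lemma enc_fact_inj : injective enc_fact.
Proof. by move=> [[k [|l]] v] [[k' [|l']] v'] //= []; do ?move=> ->. Qed.

Lemma encK : cancel enc dec.
Proof. by elim=> [|[[k [|l]] v] K IH] //=; rewrite IH. Qed.

Lemma mem_dec (f : fact) m : f \in dec m -> subterm (enc_fact f) m.
Proof.
elim: m f => [v|l|m1 IH1 m2 IH2|k m IH] f //=.
  by rewrite mem_cat => /orP[/IH1|/IH2] ?; right; [left|right].
case: m IH => [v _|//|[] //l [] //v _|//]; rewrite inE => /eqP->; by left.
Qed.

Lemma subterm_enc k x K :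
  subterm (Sig k x) (enc K) -> exists2 f, f \in K & Sig k x = enc_fact f.
Proof.
elim: K => [|[[k' l] v] K IH]; first by case.
case=> // -[|/IH[f fK ->]]; last by exists f; rewrite // inE fK orbT.
case: l => [|l] /=.
  case=> [[-> ->]|[]//]; exists (k', 0, v) => //; exact: mem_head.
case=> [[-> ->]|]; first by exists (k', l.+1, v) => //; exact: mem_head.
by case=> // -[|] [].
Qed.

End Facts.

(** * Certificates and the leading value *)

Section Certificates.
Variables (V : eqType) (n t : nat).
Implicit Types K : seq (fact V n).

Definition cert K (l : nat) (v : V) : bool := t < #|[set k | (k, l, v) \in K]|.

(** The successor leaves 0 for the absence of any certificate. *)
Definition height K : nat := \max_(f <- K | cert K f.1.2 f.2) f.1.2.+1.

Definition leading K : option V :=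
  ohead [seq f.2 | f <- K &
    if height K is l.+1 then (f.1.2 == l) && cert K l f.2 else f.1.2 == 0].

Lemma cert_sub K K' l v : {subset K <= K'} -> cert K l v -> cert K' l v.
Proof.
move=> sKK' /leq_trans; apply; apply: subset_leq_card.
by apply/subsetP => k; rewrite !inE => /sKK'.
Qed.

Lemma cert_height K l v : cert K l v -> l < height K.
Proof.
move=> c; have /card_gt0P[k] : 0 < #|[set k | (k, l, v) \in K]|.
  exact: leq_ltn_trans c.
by rewrite inE => kK; apply: (leq_bigmax_seq (k, l, v)).
Qed.

Lemma height_sub K K' : {subset K <= K'} -> height K <= height K'.
Proof.
move=> sKK'; apply/bigmax_leqP_seq => f fK cf.
by apply: cert_height (f.2) _; apply: cert_sub cf.
Qed.

Lemma leadingP K v : leading K = Some v ->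
  if height K is l.+1 then cert K l v else exists k, (k, 0, v) \in K.
Proof.
rewrite /leading; set s := map _ _ => sv.
have : v \in s by case: s sv => //= a s [->]; exact: mem_head.
case/mapP=> -[[k l] w]; rewrite mem_filter => /andP[+ kK] /= ->.
case: (height K) => [/eqP<-|h /andP[_ ->] //]; by exists k.
Qed.

(** Every node knows its own signed input, so its knowledge always has a leading value. *)
Lemma leading_claim K k v : (k, 0, v) \in K -> leading K.
Proof.
rewrite /leading => kK; set s := map _ _.
suff [w] : exists w, w \in s by case: s.
rewrite /s; case hK: (height K) => [|h].
  by exists v; apply/mapP; exists (k, 0, v); rewrite // mem_filter.
have [f fK /andP[cf /eqP hf]] :
    exists2 f, f \in K & cert K f.1.2 f.2 && (f.1.2.+1 == h.+1).
  apply/hasP; apply: contraT => /hasPn noK.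
  suff : height K <= h by rewrite hK ltnn.
  apply/bigmax_leqP_seq => f fK cf; have /= := noK f fK; have := cert_height cf.
  by rewrite cf hK /= eqSS ltnS leq_eqVlt => /orP[/eqP->|//]; rewrite eqxx.
exists f.2; apply/mapP; exists f => //.
by rewrite mem_filter fK; case: hf cf => ->; rewrite eqxx => ->.
Qed.

End Certificates.

(** * The protocol *)

Section Protocol.
Variables (V : eqType) (n t : nat).
Implicit Types (i j : 'I_n) (K : seq (fact V n)) (inb : ports V n).

Definition member (i : nat) : bool := i <= 2 * t.

(* The nodes outside the committee form chains of length [t.+1]; the node at
   position [p] of its chain is served in the four rounds of slot [t.+3 + p]. *)
Definition slot (j : nat) : nat := t.+3 + (j - (2 * t).+1) %% t.+1.

(** The first round after the last slot, [2 * t + 3]. *)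
Definition final_round : nat := 4 * (2 * t + 4).

(* Round [4 * l + q] is step [q] of slot [l].  Slot 0 exchanges inputs; slot
   [l <= t.+1] has leader [l.-1], which gathers (steps 0, 2) and spreads (steps
   1, 3) knowledge; in the slots after [t.+2] a node hears from its predecessor
   (step 0), and failing this asks the committee (steps 1, 2). *)
Definition link (r i j : nat) : bool :=
  let l := r %/ 4 in let q := r %% 4 in
  if l == 0 then [&& q == 0, member i & member j]
  else if l <= t.+1 then
    if odd q then (i.+1 == l) && member j else member i && (j.+1 == l)
  else match q with
  | 0 => [&& j == i.+1, ~~ member i & slot j == l]
  | 1 => [&& ~~ member i, slot i == l & member j]
  | 2 => [&& member i, ~~ member j & slot j == l]
  | _ => false
  end.

(** [inb] is the inbox of the previous round, so in step 2 it shows who asked in step 1. Height at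
    most [t.+2] means that no certificate of the outcome, at level [t.+2], is known. *)
Definition sends (r : nat) K inb i j : bool :=
  link r i j &&
  (if t.+2 < r %/ 4 then
     match r %% 4 with
     | 1 => height t K <= t.+2
     | 2 => isSome (inb j)
     | _ => true
     end
   else true).

Definition received (r : nat) inb i : seq (fact V n) :=
  flatten [seq oapp (@dec V n) [::] (inb j) | j <- enum 'I_n & link r j i].

(** A leader gets no message from itself and slot [t.+2] has no leader; in both cases a node
    consults its own knowledge. *)
Definition source (r : nat) K inb i : seq (fact V n) :=
  if (r %/ 4 == t.+2) || (i.+1 == r %/ 4) then K else received r inb i.

Definition voting (r i : nat) : bool :=
  [&& r %% 4 == 1, 0 < r %/ 4, r %/ 4 <= t.+2 & member i].

Definition vote (r : nat) K inb i : option V :=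
  let src := source r K inb i in
  if voting r i && (height t K <= height t src) then leading t src else None.

Definition learn i (r : nat) K inb : seq (fact V n) :=
  (if vote r K inb i is Some v then [:: (i, r %/ 4, v)] else [::]) ++
  K ++ received r inb i.

Definition know i (a : V) (h : history V n) : seq (fact V n) :=
  (foldl (fun s inb => (s.1.+1, learn i s.1 s.2 inb)) (0, [:: (i, 0, a)]) h).2.

Definition leader_protocol : protocol V n := fun i a h =>
  let K := know i a h in
  if final_round <= size h then Halt (odflt a (leading t K))
  else Send [ffun j => if sends (size h) K (last [ffun=> None] h) i j
                       then Some (enc K) else None].

Lemma final_roundE : final_round = 8 * t + 16.
Proof. by rewrite /final_round mulnDr mulnA. Qed.

Lemma round_slot l q : q < 4 -> (4 * l + q) %/ 4 = l.
Proof. by move=> q4; rewrite mulnC divnMDl // divn_small // addn0. Qed.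

Lemma round_step l q : q < 4 -> (4 * l + q) %% 4 = q.
Proof. by move=> q4; rewrite mulnC modnMDl modn_small. Qed.

Lemma slot_gt (j : nat) : t.+2 < slot j.
Proof. by rewrite /slot; lia. Qed.

Lemma slot_le (j : nat) : slot j <= 2 * t + 3.
Proof. by have := ltn_pmod (j - (2 * t).+1) (ltn0Sn t); rewrite /slot; lia. Qed.

Lemma slot_head : slot (2 * t).+1 = t.+3.
Proof. by rewrite /slot subnn mod0n addn0. Qed.

Lemma slotS (j : nat) : ~~ member j -> slot j.+1 != t.+3 -> slot j.+1 = (slot j).+1.
Proof.
rewrite /member -ltnNge /slot => jM; rewrite subSn // modnS.
by case: ifP => _; rewrite ?addn0 ?eqxx // addnS.
Qed.

Lemma link_inputs q (i j : nat) : q < 4 ->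
  link q i j = [&& q == 0, member i & member j].
Proof. by case: q => [|[|[|[|]]]]. Qed.

Lemma link_leader l q (i j : nat) : 0 < l <= t.+1 -> q < 4 ->
  link (4 * l + q) i j =
  if odd q then (i.+1 == l) && member j else member i && (j.+1 == l).
Proof.
move=> /andP[l0 lt] q4; rewrite /link round_slot // round_step // lt.
by case: l l0 {lt}.
Qed.

Lemma link_late l q (i j : nat) : t.+1 < l -> q < 4 ->
  link (4 * l + q) i j =
  match q with
  | 0 => [&& j == i.+1, ~~ member i & slot j == l]
  | 1 => [&& ~~ member i, slot i == l & member j]
  | 2 => [&& member i, ~~ member j & slot j == l]
  | _ => false
  end.
Proof.
move=> lt q4; rewrite /link round_slot // round_step // leqNgt lt.
by case: l lt.
Qed.

Lemma know_rcons i a h inb :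
  know i a (rcons h inb) = learn i (size h) (know i a h) inb.
Proof.
rewrite /know -cats1 foldl_cat /=; congr (learn i _ _ inb).
by elim/last_ind: h => //= h b IH; rewrite -cats1 foldl_cat size_cat /= IH addn1.
Qed.

Lemma receivedP r inb i f :
  reflect (exists j m, [/\ link r j i, inb j = Some m & f \in dec m])
          (f \in received r inb i).
Proof.
apply: (iffP flattenP) => [[s /mapP[j]]|[j [m [lj im fm]]]].
  rewrite mem_filter => /andP[lj _] ->; case im: (inb j) => [m|//] fm.
  by exists j, m.
exists (dec m) => //; apply/mapP; exists j; last by rewrite im.
by rewrite mem_filter lj mem_enum.
Qed.

Lemma learnP i r K inb f :
  reflect [\/ f.1.1 = i /\ f.1.2 = r %/ 4 /\ vote r K inb i = Some f.2,
              f \in K | f \in received r inb i]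
          (f \in learn i r K inb).
Proof.
rewrite /learn !mem_cat; case: f => [[k l] w] /=.
apply: (iffP idP) => [/or3P[|?|?]|[[-> [-> ->]]|->|->]]; rewrite ?orbT //.
- by case: vote => //= v; rewrite inE => /eqP[-> -> ->]; constructor 1.
- by constructor 2.
- by constructor 3.
- by rewrite mem_head.
Qed.

Lemma know_origin i a h f : f \in know i a h ->
  f.1.1 = i \/ exists r l m, nth [ffun=> None] h r l = Some m /\ f \in dec m.
Proof.
elim/last_ind: h => [|h inb IH]; first by rewrite inE => /eqP->; left.
rewrite know_rcons => /learnP[[-> _]||/receivedP[j [m [_ jm fm]]]]; first by left.
  case/IH=> [->|[r [l [m [hm fm]]]]]; first by left.
  right; exists r, l, m; split=> //; rewrite nth_rcons.
  case: ltnP => [//|hr]; by rewrite nth_default // ffunE in hm.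
by right; exists (size h), j, m; rewrite nth_rcons ltnn eqxx.
Qed.

Lemma leader_protocol_signatures : respects_signatures leader_protocol.
Proof.
move=> i a h out j m k x; rewrite /leader_protocol; case: ifP => // _ [<-].
rewrite ffunE; case: ifP => // _ [<-] /subterm_enc[f fK ekx].
have [fi|[r [l [m' [hm fm]]]]] := know_origin fK.
  by left; rewrite -fi; case: ekx.
by right; exists r, l, m'; split=> //; rewrite ekx; apply: mem_dec.
Qed.

End Protocol.

(** * Counting *)

Lemma card_ord_ltn (n m : nat) : m <= n -> #|[set i : 'I_n | i < m]| = m.
Proof.
move=> le_mn; rewrite -[RHS]card_ord.
rewrite -(card_imset predT (f := widen_ord le_mn)); last first.
  by move=> i j [] /ord_inj.
apply: eq_card => i; rewrite inE; apply/idP/imsetP => [im|[j _ ->]].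
  by exists (Ordinal im) => //; apply: ord_inj.
exact: (ltn_ord j).
Qed.

Lemma sum_bool_le1 (m : nat) (P : pred 'I_m) :
  (forall i j, P i -> P j -> i = j) -> \sum_(i < m) P i <= 1.
Proof.
move=> P1; rewrite (eq_bigr (fun i => if P i then 1 else 0)) => [|i _]; last first.
  by case: (P i).
rewrite -big_mkcond sum1dep_card; apply/card_le1_eqP => i j; rewrite !inE.
by move=> *; apply: P1.
Qed.

Lemma sum_eq_le1 (m c : nat) : \sum_(i < m) (i == c :> nat) <= 1.
Proof. by apply: sum_bool_le1 => i j /eqP ic /eqP jc; apply: ord_inj; rewrite ic jc. Qed.

Lemma sum_succ_le1 (m c : nat) : \sum_(i < m) (i.+1 == c) <= 1.
Proof.
by apply: sum_bool_le1 => i j /eqP ic /eqP jc; apply/ord_inj/succn_inj; rewrite ic jc.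
Qed.

Lemma sum_ltn_le (m c : nat) : \sum_(i < m) (i < c) <= c.
Proof.
elim: m => [|m IH]; first by rewrite big_ord0.
have [mc|cm] := ltnP m c; last by rewrite big_ord_recr /= ltnNge cm addn0.
apply: leq_trans mc; rewrite -[X in _ <= X]card_ord -sum1_card.
by apply: leq_sum => i _; exact: leq_b1.
Qed.

Lemma sum3D (R n : nat) (F G : 'I_R -> 'I_n -> 'I_n -> nat) :
  \sum_r \sum_i \sum_j (F r i j + G r i j) =
  \sum_r \sum_i \sum_j F r i j + \sum_r \sum_i \sum_j G r i j.
Proof.
rewrite -big_split; apply: eq_bigr => r _ /=; rewrite -big_split.
by apply: eq_bigr => i _ /=; rewrite -big_split.
Qed.

(** Traffic tied to one round per link is counted by links alone, whatever [R] is. *)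
Lemma sum_at_round (R n : nat) (c X : 'I_n -> 'I_n -> nat) :
  \sum_(r < R) \sum_i \sum_j (r == c i j :> nat) * X i j <= \sum_i \sum_j X i j.
Proof.
rewrite exchange_big /=; apply: leq_sum => i _.
rewrite exchange_big /=; apply: leq_sum => j _.
by rewrite -big_distrl -{2}[X i j]mul1n leq_mul2r sum_eq_le1 orbT.
Qed.

(** A head has remainder 0 modulo [t.+1] past the committee, so the quotient, the index of its
    chain, determines it. *)
Lemma card_chain_heads (n t : nat) :
  \sum_(i < n) (~~ member t i && (slot t i == t.+3)) <= (n %/ t.+1).+1.
Proof.
rewrite (eq_bigr (fun i : 'I_n =>
  if ~~ member t i && (slot t i == t.+3) then 1 else 0)) => [|i _]; last first.
  by case: (_ && _).
rewrite -big_mkcond sum1dep_card /=; set A := [set _ | _].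
pose f (i : 'I_n) : 'I_(n %/ t.+1).+1 := inord ((i - (2 * t).+1) %/ t.+1).
rewrite -[X in _ <= X]card_ord -(card_in_imset (f := f)) ?max_card //.
have slot0 a : (t.+3 + a == t.+3) = (a == 0).
  by rewrite -[X in _ == X]addn0 eqn_add2l.
move=> i j; rewrite !inE /member /slot -!ltnNge !slot0.
move=> /andP[iM /eqP i0] /andP[jM /eqP j0] /(congr1 val).
have lt_div (a : 'I_n) : (a - (2 * t).+1) %/ t.+1 < (n %/ t.+1).+1.
  by rewrite ltnS leq_div2r // (leq_trans (leq_subr _ _)) // ltnW.
rewrite /f /= !inordK // => ij; apply: ord_inj.
have := divn_eq (i - (2 * t).+1) t.+1; rewrite ij i0.
have := divn_eq (j - (2 * t).+1) t.+1; rewrite j0 => <-; lia.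
Qed.

(** * Executions *)

Section Run.
Variables (V : eqType) (n t : nat) (inp : 'I_n -> V) (B : {set 'I_n}).
Variable tr : traffic V n.
Hypothesis tn : 2 * t < n.
Hypothesis Bt : #|B| <= t.
Hypothesis run : execution (@leader_protocol V n t) inp B tr.
Implicit Types (i j k : 'I_n) (r l : nat) (v w : V) (K : seq (fact V n)).

Local Notation final_round := (final_round t).
Local Notation height := (height t).
Local Notation leading := (leading t).
Local Notation cert := (cert t).
Local Notation member := (member t).
Local Notation link := (link t).
Local Notation slot := (slot t).

Let inbox r i : ports V n := [ffun j => tr r j i].
Let kn i r := know t i (inp i) (local_history tr i r).

Lemma size_local_history i r : size (local_history tr i r) = r.
Proof. by rewrite size_map size_iota. Qed.

Lemma local_historyS i r :
  local_history tr i r.+1 = rcons (local_history tr i r) (inbox r i).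
Proof. by rewrite /local_history -addn1 iotaD map_cat cats1. Qed.

Lemma knS i r : kn i r.+1 = learn t i r (kn i r) (inbox r i).
Proof. by rewrite /kn local_historyS know_rcons size_local_history. Qed.

Lemma kn_sub i r r' : r <= r' -> {subset kn i r <= kn i r'}.
Proof.
move=> /subnK <-; elim: (r' - r) => // d IH f /IH fK.
by rewrite addSn knS; apply/learnP; constructor 2.
Qed.

Lemma kn_claim i r : (i, 0, inp i) \in kn i r.
Proof. by apply: (@kn_sub i 0) => //; apply: mem_head. Qed.

Lemma next_action_halt i r :
  is_halt (next_action (@leader_protocol V n t) inp tr i r) = (final_round <= r).
Proof.
by rewrite /next_action /leader_protocol size_local_history; case: ifP.
Qed.

Lemma halted_final i r :
  halted (@leader_protocol V n t) inp tr i r = (final_round <= r).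
Proof.
apply/hasP/idP => [[s]|fr].
  by rewrite mem_iota next_action_halt => sr /leq_trans; apply; lia.
by exists r; rewrite ?next_action_halt // mem_iota; lia.
Qed.

Lemma tr_correct r i j : i \notin B ->
  tr r i j = if [&& j != i, r < final_round &
                    sends t r (kn i r) (last [ffun=> None] (local_history tr i r)) i j]
             then Some (enc (kn i r)) else None.
Proof.
case: run => _ tr_prescribed _ iB; rewrite tr_prescribed // /prescribed halted_final.
case: eqP => //= _; case: leqP => //= r_lt.
by rewrite /next_action /leader_protocol size_local_history leqNgt r_lt /= ffunE.
Qed.

Lemma tr_correctP r i j m : i \notin B -> tr r i j = Some m -> m = enc (kn i r).
Proof. by move=> iB; rewrite tr_correct //; case: ifP => // _ [<-]. Qed.

Lemma deliver r i j : i \notin B -> r < final_round ->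
  sends t r (kn i r) (last [ffun=> None] (local_history tr i r)) i j ->
  {subset kn i r <= kn j r.+1}.
Proof.
move=> iB r_lt sij f fK; have [->|ji] := eqVneq j i; first exact: kn_sub fK.
rewrite knS; apply/learnP; constructor 3; apply/receivedP.
exists i, (enc (kn i r)); split; [by case/andP: sij | | by rewrite encK].
by rewrite ffunE tr_correct // ji r_lt sij.
Qed.

Lemma deliver_static r i j : i \notin B -> r < final_round -> link r i j ->
  (r %/ 4 <= t.+2) || (r %% 4 == 0) -> {subset kn i r <= kn j r.+1}.
Proof.
move=> iB r_lt lij rP; apply: deliver => //; rewrite /sends lij /=.
by case: ltnP rP => //= _ /eqP->.
Qed.

(** * Unforgeability and the origin of votes *)

(** Both claims go through one induction: a vote of another node is learnt from a message only,
    whose sender either is correct and knew the vote, or is faulty and relies on an earlier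
    delivery. *)
Lemma unforgeable r k l v : k \notin B ->
  (forall i, i \notin B -> (k, l, v) \in kn i r -> (k, l, v) \in kn k r) /\
  (forall i j m, tr r i j = Some m -> subterm (enc_fact (k, l, v)) m ->
     (k, l, v) \in kn k r).
Proof.
move=> kB; elim/ltn_ind: r => r IH.
suff kn_r i : i \notin B -> (k, l, v) \in kn i r -> (k, l, v) \in kn k r.
  split=> // i j m ijm sm; have [iB|iB] := boolP (i \in B).
    case: run => _ _ /(_ r i j m k _ iB ijm sm)[|[s [a [b [m' [sr _ abm sm']]]]]].
      by rewrite (negPf kB).
    by apply: kn_sub (ltnW sr) _ _; apply: (IH s sr).2 abm sm'.
  apply: (kn_r i iB); move: sm; rewrite (tr_correctP iB ijm).
  by case/subterm_enc => f fK /enc_fact_inj->.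
have [<- //|ki] := eqVneq k i.
case: r IH => [_ _|r IH iB]; first by rewrite inE => /eqP[ki']; rewrite ki' eqxx in ki.
rewrite knS => /learnP[/= [ki' _]|fK|/receivedP[j [m [_]]]].
- by rewrite ki' eqxx in ki.
- by apply: kn_sub (leqnSn r) _ _; apply: (IH r (ltnSn r)).1 fK.
rewrite ffunE => jm fm; apply: kn_sub (leqnSn r) _ _.
by apply: (IH r (ltnSn r)).2 jm _; apply: mem_dec.
Qed.

Let src r i := source t r (kn i r) (inbox r i) i.

(** By unforgeability, a vote of [k] that comes back to [k] was known to it already. *)
Lemma own_fact k r l v : k \notin B -> (k, l, v) \in kn k r ->
  l = 0 /\ v = inp k \/
  exists s, [/\ s < r, s %/ 4 = l, voting t s k,
                height (kn k s) <= height (src s k) & leading (src s k) = Some v].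
Proof.
move=> kB; elim: r => [|r IH]; first by rewrite inE => /eqP[-> ->]; left.
have {}IH : (k, l, v) \in kn k r -> l = 0 /\ v = inp k \/
    exists s, [/\ s < r.+1, s %/ 4 = l, voting t s k,
                height (kn k s) <= height (src s k) & leading (src s k) = Some v].
  by case/IH => [|[s [sr]]]; [left | right; exists s; split=> //; apply: ltnW].
rewrite knS => /learnP[[/= _ [-> ]]|/IH//|/receivedP[j [m [_]]]].
  rewrite /vote -/(src r k); case: ifP => // /andP[vr hr] lr; right.
  by exists r.
rewrite ffunE => jm /mem_dec fm; apply: IH.
exact: (unforgeable r l v kB).2 jm fm.
Qed.

(** Holds for the knowledge of a correct node and also for a proposal from a faulty leader, which
    may withhold correct votes but cannot invent them. *)
Definition known_at r K : Prop :=
  forall k l v, k \notin B -> (k, l, v) \in K -> (k, l, v) \in kn k r.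

Lemma known_kn i r : i \notin B -> known_at r (kn i r).
Proof. by move=> iB k l v kB; apply: (unforgeable r l v kB).1. Qed.

Lemma known_src i r : i \notin B -> known_at r (src r i).
Proof.
move=> iB k l v kB; rewrite /src /source.
case: ifP => _; first exact: known_kn.
case/receivedP=> j [m [_]]; rewrite ffunE => jm /mem_dec fm.
exact: (unforgeable r l v kB).2 jm fm.
Qed.

Lemma cert_correct K l v : cert K l v -> exists2 k, k \notin B & (k, l, v) \in K.
Proof.
move=> c; have /subsetPn[k] : ~~ ([set k | (k, l, v) \in K] \subset B).
  apply: contraL c => /subset_leq_card KB; rewrite -leqNgt.
  exact: leq_trans KB Bt.
by rewrite inE => kK kB; exists k.
Qed.

(** At least [t.+1] of the [2 * t + 1] members are correct. *)
Lemma cert_members K l v :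
  (forall k, member k -> k \notin B -> (k, l, v) \in K) -> cert K l v.
Proof.
move=> KP; pose M := [set k : 'I_n | k < (2 * t).+1].
have MB : M :\: B \subset [set k | (k, l, v) \in K].
  by apply/subsetP => k; rewrite !inE ltnS => /andP[kB kM]; apply: KP.
apply: leq_trans (subset_leq_card MB).
have := cardsID B M; rewrite card_ord_ltn //.
have := leq_trans (subset_leq_card (subsetIr M B)) Bt.
by move: #|M :&: B| #|M :\: B| => a b; lia.
Qed.

Lemma leading_voter r K v : known_at r K -> 0 < height K -> leading K = Some v ->
  exists2 k, k \notin B & (k, (height K).-1, v) \in kn k r.
Proof.
move=> rK hK /leadingP; case: (height K) hK => // h _ /cert_correct[k kB kK].
by exists k => //; apply: rK.
Qed.

(** * Validity of the leading value *)

Lemma claimed_fact i r k v : i \notin B ->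
  (k, 0, v) \in kn i r \/ (k, 0, v) \in src r i -> claimed_input inp B tr k v.
Proof.
move=> iB kP; rewrite /claimed_input; case: (boolP (k \in B)) => kB; last first.
  have : (k, 0, v) \in kn k r by case: kP; [apply: known_kn | apply: known_src].
  (* No vote is cast in slot 0, so a correct node signs only its input at level 0. *)
  case/(own_fact kB) => [[_ ->] //|[s [_ s0 vs _ _]]].
  by move: vs; rewrite /voting s0 andbF.
have recv s : (k, 0, v) \in received t s (inbox s i) i ->
    exists r0 i0 j0 m, tr r0 i0 j0 = Some m /\ subterm (Sig k (Val v)) m.
  case/receivedP=> j [m [_]]; rewrite ffunE => jm /mem_dec fm.
  by exists s, j, i, m.
have {}kn_tr : (k, 0, v) \in kn i r ->
    exists r0 i0 j0 m, tr r0 i0 j0 = Some m /\ subterm (Sig k (Val v)) m.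
  elim: r {kP} => [|r IH].
    by rewrite inE => /eqP[ki]; rewrite ki (negPf iB) in kB.
  rewrite knS => /learnP[[/= ki]|/IH//|/recv//].
  by rewrite ki (negPf iB) in kB.
case: kP => //; rewrite /src /source; case: ifP => // _; exact: recv.
Qed.

(** A certified value has a correct voter, for whom it was the leading value of a source in an
    earlier round; this descent ends at a signed input. *)
Lemma leading_claimed i r v : i \notin B ->
  leading (kn i r) = Some v \/ leading (src r i) = Some v ->
  exists k, claimed_input inp B tr k v.
Proof.
elim/ltn_ind: r i v => r IH i v iB.
suff sP K : known_at r K ->
    (forall k, (k, 0, v) \in K -> (k, 0, v) \in kn i r \/ (k, 0, v) \in src r i) ->
    leading K = Some v -> exists k, claimed_input inp B tr k v.
  by case=> ?; [apply: (sP (kn i r)) | apply: (sP (src r i))] => //;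
    [exact: known_kn | by left | exact: known_src | by right].
move=> rK claims lK; case: (posnP (height K)) => hK.
  have := leadingP lK; rewrite hK => -[k /claims kK].
  by exists k; apply: claimed_fact iB kK.
have [k kB kK] := leading_voter rK hK lK.
case: (own_fact kB kK) => [[_ ->]|[s [sr _ _ _ ls]]].
  by exists k; rewrite /claimed_input (negPf kB).
by apply: (IH s sr k v kB); right.
Qed.

Lemma height_unanimous v i r : (forall k, k \notin B -> inp k = v) ->
  member i -> i \notin B -> 0 < r -> 0 < height (kn i r).
Proof.
move=> inp_v iM iB r_gt0; apply: (@cert_height _ _ _ _ 0 v).
apply: cert_members => k kM kB; apply: kn_sub r_gt0 _ _.
apply: (deliver_static (i := k) (r := 0)) => //.
- by rewrite final_roundE addn_gt0 orbT.
- by rewrite link_inputs // kM.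
- by rewrite -(inp_v k kB) kn_claim.
Qed.

(** From round 1 on correct members hold a certificate of level 0, so a source they accept is
    certified too, and its leading value has an earlier correct voter. *)
Lemma unanimous v k r l w : (forall k, k \notin B -> inp k = v) ->
  k \notin B -> (k, l, w) \in kn k r -> w = v.
Proof.
move=> inp_v; elim/ltn_ind: r k l w => r IH k l w kB.
case/(own_fact kB) => [[_ ->]|[s [sr _ vs hs ls]]]; first exact: inp_v.
case/and4P: vs => s1 _ _ kM; have s_gt0 : 0 < s by case: s s1 {sr hs ls}.
have h_gt0 := leq_trans (height_unanimous inp_v kM kB s_gt0) hs.
have [k' kB' kK] := leading_voter (known_src kB) h_gt0 ls.
exact: (IH s sr _ _ _ kB' kK).
Qed.

Lemma correct_leader : exists2 k, k \notin B & k <= t.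
Proof.
have /subsetPn[k] : ~~ ([set k : 'I_n | k < t.+1] \subset B).
  apply/negP => /subset_leq_card; rewrite card_ord_ltn => [tB|]; last by lia.
  by have := leq_trans tB Bt; rewrite ltnn.
by rewrite inE => kt kB; exists k.
Qed.

(** * The effect of a correct leader *)

Section AfterLeader.
Variable k0 : 'I_n.
Hypothesis k0B : k0 \notin B.
Hypothesis k0t : k0 <= t.

Let l0 := k0.+1.

Lemma gathered i q : i \notin B -> member i -> (q == 0) || (q == 2) ->
  {subset kn i (4 * l0 + q) <= kn k0 (4 * l0 + q).+1}.
Proof.
move=> iB iM q02; have q4 : q < 4 by case/orP: q02 => /eqP->.
apply: deliver_static => //.
- by rewrite final_roundE /l0; lia.
- by rewrite link_leader //= iM eqxx; case/orP: q02 => /eqP->.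
- by rewrite round_slot // /l0; apply/orP; left; lia.
Qed.

Lemma spread i : member i ->
  {subset kn k0 (4 * l0 + 3) <= kn i (4 * l0 + 4)}.
Proof.
move=> iM; rewrite [4 * l0 + 4]addnS; apply: deliver_static => //.
- by rewrite final_roundE /l0; lia.
- by rewrite link_leader //= iM eqxx.
- by rewrite round_slot // /l0; apply/orP; left; lia.
Qed.

(** In step 0 of the slot nobody votes and only the leader receives, so a member has nothing beyond
    what it has just sent. *)
Lemma kn_before_proposal i : i \notin B -> member i ->
  {subset kn i (4 * l0 + 1) <= kn k0 (4 * l0 + 1)}.
Proof.
move=> iB iM f; have [-> //|ik] := eqVneq i k0.
move=> fK; rewrite addn1 -[X in X.+1]addn0; apply: (gathered iB iM) => //.
move: fK; rewrite addn0 addn1 knS => /learnP[[_ [_]]|//|].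
  by rewrite /vote /voting -[4 * l0]addn0 round_step.
case/receivedP=> j [m []]; rewrite -[4 * l0]addn0 link_leader //=.
by rewrite /l0 eqSS (inj_eq val_inj) (negPf ik) andbF.
Qed.

(** All correct members thus judge the same proposal. *)
Lemma src_leader i : i \notin B -> member i ->
  src (4 * l0 + 1) i = kn k0 (4 * l0 + 1).
Proof.
move=> iB iM; rewrite /src /source round_slot //.
have -> : (l0 == t.+2) = false by rewrite /l0; lia.
rewrite eqSS /= (inj_eq val_inj); have [-> //|ik] := eqVneq i k0.
rewrite /received (eq_filter (a2 := pred1 k0)); last first.
  by move=> j; rewrite link_leader //= iM andbT eqSS.
rewrite filter_pred1_uniq ?enum_uniq ?mem_enum //= cats0 ffunE tr_correct //.
rewrite ik /sends link_leader //= eqxx iM round_slot // ifT /=; first by rewrite encK.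
have -> : t.+2 < l0 = false by rewrite /l0; lia.
by rewrite andbT final_roundE /l0; lia.
Qed.

Lemma leader_value : exists v, leading (kn k0 (4 * l0 + 1)) = Some v.
Proof. by have := leading_claim t (kn_claim k0 (4 * l0 + 1)); case: leading => // v; exists v. Qed.

Variable v0 : V.
Hypothesis k0v : leading (kn k0 (4 * l0 + 1)) = Some v0.

(** By [kn_before_proposal] the leader is at least as high as each correct member, so none
    abstains. *)
Lemma leader_vote i : i \notin B -> member i ->
  (i, l0, v0) \in kn i (4 * l0 + 2).
Proof.
move=> iB iM; rewrite addnS knS; apply/learnP; constructor 1; rewrite /= round_slot //.
split=> //; split=> //; rewrite /vote -/(src _ _) src_leader // k0v ifT //.
rewrite /voting round_slot // round_step // iM height_sub ?andbT //=.
  by rewrite /l0; lia.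
exact: kn_before_proposal.
Qed.

Lemma leader_cert i r : i \notin B -> member i -> 4 * l0 + 4 <= r ->
  cert (kn i r) l0 v0.
Proof.
move=> iB iM rP; apply: cert_members => k kM kB; apply: kn_sub rP _ _.
by apply: spread => //; rewrite addnS; apply: (gathered kB kM) => //; apply: leader_vote.
Qed.

Lemma voting_round s k l : voting t s k -> s %/ 4 = l -> s = 4 * l + 1.
Proof. by case/and4P=> /eqP s1 _ _ _ <-; rewrite {1}(divn_eq s 4) s1 mulnC. Qed.

(* A vote above level [l0] needs a source as high as the certificate that every
   correct member holds, hence one certified by a correct vote for [v0]. *)
Lemma locked k r l w : k \notin B -> l0 <= l -> (k, l, w) \in kn k r -> w = v0.
Proof.
elim/ltn_ind: r k l w => r IH k l w kB l0l.
case/(own_fact kB) => [[l_0]|[s [sr sl vs hs ls]]]; first by rewrite l_0 in l0l.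
have es := voting_round vs sl; case/and4P: vs => _ _ _ kM.
case: (ltngtP l0 l) l0l => // [ltl _|el _]; last first.
  (* At level [l0] itself, all correct members take the leading value of the same source. *)
  by move: ls; rewrite es -el src_leader // k0v => -[].
have hk : l0 < height (kn k s) by apply: cert_height (leader_cert _ _ _); lia.
have hk' := leq_trans hk hs.
have [k' kB' kK] := leading_voter (known_src kB) (leq_ltn_trans (leq0n _) hk') ls.
by apply: (IH s sr _ _ _ kB' _ kK); lia.
Qed.

Lemma leading_locked i r : i \notin B -> l0 < height (kn i r) ->
  leading (kn i r) = Some v0.
Proof.
move=> iB hi; have := leading_claim t (kn_claim i r).
case li: (leading _) => [w|//] _.
have [k kB kK] := leading_voter (known_kn iB) (leq_ltn_trans (leq0n _) hi) li.
by congr Some; apply: locked kB _ kK; lia.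
Qed.

(** In slot [t.+2] a member consults its own knowledge, where [v0] is locked. *)
Lemma member_final i r : i \notin B -> member i -> 4 * t.+3 <= r ->
  (i, t.+2, v0) \in kn i r.
Proof.
move=> iB iM rP; apply: (@kn_sub i (4 * t.+2 + 1).+1); first by lia.
rewrite knS; apply/learnP; constructor 1; rewrite /= round_slot //.
split=> //; split=> //; rewrite /vote /source round_slot // eqxx /= leqnn andbT.
rewrite /voting round_slot // round_step // iM leqnn /=; apply: leading_locked => //.
by apply: cert_height (leader_cert _ _ _) => //; rewrite /l0; lia.
Qed.

(** * Dissemination outside the committee *)

Lemma served_by_committee j : j \notin B -> ~~ member j ->
  height (kn j (4 * slot j + 1)) <= t.+2 -> t.+2 < height (kn j (4 * slot j + 3)).
Proof.
move=> jB jM hj; apply: (@cert_height _ _ _ _ t.+2 v0).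
apply: cert_members => i iM iB; rewrite addnS.
have lt_slot := slot_gt t j; have slot_lt := slot_le t j.
have ij : i != j by apply: contraNneq jM => <-.
apply: (deliver (i := i)) => //; first by rewrite final_roundE; lia.
  (* The answer in step 2 depends on the inbox of step 1, where the request of [j] is found. *)
  rewrite [X in local_history _ _ X]addnS local_historyS last_rcons.
  rewrite /sends link_late //; last by lia.
  rewrite iM jM eqxx round_slot // round_step // lt_slot ffunE tr_correct // ij.
  rewrite /sends link_late //; last by lia.
  rewrite iM jM eqxx round_slot // round_step // lt_slot hj /= andbT.
  by rewrite final_roundE ifT //; lia.
by apply: member_final => //; lia.
Qed.

Lemma outsider_final j r : j \notin B -> ~~ member j -> 4 * slot j + 3 <= r ->
  t.+2 < height (kn j r).
Proof.
move=> jB jM rP; apply: leq_trans (height_sub t (kn_sub rP)).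
case: (leqP (height (kn j (4 * slot j + 1))) t.+2) => hj.
  exact: served_by_committee.
by apply: leq_trans hj (height_sub t _); apply: kn_sub; lia.
Qed.

(** The slot of [i] is over when that of [j] begins, so [i] already has the certificate to pass
    on. *)
Lemma served_by_predecessor i j : i \notin B -> ~~ member i -> j = i.+1 :> nat ->
  slot j != t.+3 -> t.+2 < height (kn j (4 * slot j + 1)).
Proof.
move=> iB iM ji sj.
have eij : slot j = (slot i).+1 by move: sj; rewrite ji; apply: slotS.
have lt_slot := slot_gt t j; have slot_lt := slot_le t j.
have /leq_trans : t.+2 < height (kn i (4 * slot j)) by apply: outsider_final; lia.
apply; apply: height_sub; rewrite addn1; apply: deliver_static => //.
- by rewrite final_roundE; lia.
- rewrite -[4 * slot j]addn0 link_late //; last by lia.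
  by rewrite iM eqxx andbT ji eqxx.
- by rewrite -[4 * slot j]addn0 round_step // orbT.
Qed.

Lemma height_final i : i \notin B -> l0 < height (kn i final_round).
Proof.
move=> iB.
have [iM|iM] := boolP (member i).
  by apply: cert_height (leader_cert _ _ _) => //; rewrite final_roundE /l0; lia.
apply: (@leq_ltn_trans t.+1); first by rewrite /l0; lia.
apply: ltnW; apply: outsider_final => //.
by have := slot_le t i; rewrite final_roundE; lia.
Qed.

Lemma leading_final i : i \notin B -> leading (kn i final_round) = Some v0.
Proof. by move=> iB; apply: leading_locked (height_final iB). Qed.

(** * Message complexity *)

(* Bounds the number of reasons for which an outsider [j] must ask. *)
Let weight (j : 'I_n) : nat :=
  (~~ member j && (slot j == t.+3)) + \sum_(b in B) (b.+1 == j).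

(** A correct predecessor would have served [j]; so [j] is a head or follows a faulty node. *)
Lemma weight_gt0 j : j \notin B -> ~~ member j ->
  height (kn j (4 * slot j + 1)) <= t.+2 -> 0 < weight j.
Proof.
move=> jB jM hj; rewrite /weight jM addn_gt0; have [//|sj] := eqVneq (slot j) t.+3.
(* The first outsider is a head, so [j] comes later and its predecessor is an outsider. *)
have j_gt : (2 * t).+1 < j.
  rewrite ltn_neqAle [_ < j]ltnNge jM andbT; apply: contraNneq sj => <-.
  by rewrite slot_head.
have [i ji] : exists i : 'I_n, j = i.+1 :> nat.
  have ltjn : j.-1 < n by have := ltn_ord j; lia.
  by exists (Ordinal ltjn); rewrite /= prednK //; lia.
have iM : ~~ member i by rewrite -ltnNge; lia.
have [iB|iB] := boolP (i \in B); last first.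
  by have := served_by_predecessor iB iM ji sj; lia.
by rewrite (bigD1 i) //= ji eqxx.
Qed.

Lemma sum_weight : \sum_j weight j <= (n %/ t.+1).+1 + t.
Proof.
rewrite big_split /= leq_add ?card_chain_heads // exchange_big /=.
apply: leq_trans Bt; rewrite -sum1_card; apply: leq_sum => b _.
by under eq_bigr => j _ do rewrite eq_sym; exact: sum_eq_le1.
Qed.

Lemma ask_weight j i l : j \notin B -> t.+2 < l ->
  tr (4 * l + 1) j i -> 0 < weight j.
Proof.
move=> jB tl; rewrite tr_correct //; case: ifP => // /and3P[_ _ +] _.
rewrite /sends link_late //; last by lia.
rewrite round_slot // round_step // tl => /andP[/and3P[jM /eqP sj _]].
by rewrite -sj => hj; apply: weight_gt0.
Qed.

Lemma tr_bound r i j : i \notin B ->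
  isSome (tr r i j) <=
    (r == 0) * (member i * member j)
  + (r < 4 * t.+2) * ((i.+1 == r %/ 4) * member j + member i * (j.+1 == r %/ 4))
  + (r == 4 * slot j) * (j == i.+1 :> nat)
  + (r == 4 * slot i + 1) * (weight i * member j)
  + (r == 4 * slot j + 2) * (member i * ((j \in B) + weight j)).
Proof.
move=> iB; case E: (isSome _) => //; have trE := E; move: E.
rewrite tr_correct //; case: ifP => // /and3P[_ _ /andP[+ +]] _.
have q4 : r %% 4 < 4 by rewrite ltn_mod.
move: (divn_eq r 4) trE; rewrite mulnC; move: (r %/ 4) (r %% 4) q4 => l q q4 ->.
move=> trE.
case: (posnP l) => [->|l_gt0].
  by rewrite muln0 add0n link_inputs // => /and3P[/eqP-> -> ->].
case: (leqP l t.+1) => tl.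
  rewrite link_leader ?l_gt0 // => lk _.
  have -> : 4 * l + q < 4 * t.+2 by lia.
  by move: lk; case: odd => /andP[-> ->]; lia.
rewrite link_late //; case: q q4 trE => [|[|[|[|//]]]] _ trE.
- by case/and3P=> -> _ /eqP->; rewrite addn0 eqxx; lia.
- move=> /and3P[iM /eqP sl ->] _.
  have : 0 < weight i by apply: ask_weight iB _ trE; have := slot_gt t i; lia.
  by rewrite sl eqxx; lia.
- move=> /and3P[-> jM /eqP sl]; have := slot_gt t j; rewrite sl => tl'.
  rewrite tl' [X in local_history _ _ X]addnS local_historyS last_rcons ffunE => aj.
  have : 0 < (j \in B) + weight j.
    by case: (boolP (j \in B)) => // jB; rewrite (ask_weight jB tl' aj).
  by rewrite eqxx; lia.
- by [].
Qed.

Lemma sum_member : \sum_(i < n) member i <= 2 * t + 1.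
Proof. by rewrite addn1; apply: sum_ltn_le. Qed.

Lemma messages_le R : messages B tr R <= 100 * (t ^ 2 + n).
Proof.
pose D := n %/ t.+1.
(* Makes the number of chains times the committee size linear in [n]; additive constants are
   absorbed by [n > 0]. *)
have Dn : D * t.+1 <= n by apply: leq_divM.
apply: (@leq_trans (((2 * t + 1) * (2 * t + 1)
    + (4 * t.+2) * (2 * t + 1 + (2 * t + 1)) + n
    + (D.+1 + t) * (2 * t + 1)) + (2 * t + 1) * (t + (D.+1 + t)))); last by nia.
have step1 : messages B tr R <= \sum_(r < R) \sum_(i < n) \sum_(j < n) (
    (r == 0 :> nat) * (member i * member j)
  + (r < 4 * t.+2) * ((i.+1 == r %/ 4) * member j + member i * (j.+1 == r %/ 4))
  + (r == 4 * slot j :> nat) * (j == i.+1 :> nat)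
  + (r == 4 * slot i + 1 :> nat) * (weight i * member j)
  + (r == 4 * slot j + 2 :> nat) * (member i * ((j \in B) + weight j))).
  apply: leq_sum => r _; rewrite [X in _ <= X](bigID (fun i => i \in ~: B)) /=.
  apply: leq_trans (leq_addr _ _); apply: leq_sum => i; rewrite inE => iB.
  by apply: leq_sum => j _; apply: tr_bound.
apply: leq_trans step1 _.
rewrite !sum3D; apply: leq_add; last first.
  apply: leq_trans (sum_at_round _ _ _) _; rewrite -big_distrlr /=.
  apply: leq_mul sum_member _; rewrite big_split /= leq_add ?sum_weight //.
  by rewrite -[X in X <= _]big_mkcond sum1_card.
apply: leq_add; last first.
  apply: leq_trans (sum_at_round _ _ _) _; rewrite -big_distrlr /=.
  exact: leq_mul sum_weight sum_member.
apply: leq_add; last first.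
  apply: leq_trans (sum_at_round _ _ _) _.
  rewrite -[X in _ <= X]card_ord -sum1_card.
  by apply: leq_sum => i _; exact: sum_eq_le1.
apply: leq_add.
  apply: leq_trans (sum_at_round _ _ _) _; rewrite -big_distrlr /=.
  exact: leq_mul sum_member sum_member.
(* Each of these rounds has at most one leader, at one end of every message. *)
apply: leq_trans (leq_mul (sum_ltn_le R (4 * t.+2)) (leqnn _)).
rewrite big_distrl; apply: leq_sum => r _ /=.
under eq_bigr => i _ do rewrite -big_distrr.
rewrite -big_distrr leq_mul2l; apply/orP; right.
under eq_bigr => i _ do rewrite big_split.
rewrite big_split -!big_distrlr /= leq_add //.
  by rewrite -[X in _ <= X]mul1n; apply: leq_mul (sum_succ_le1 _ _) sum_member.
by rewrite -[X in _ <= X]muln1; apply: leq_mul sum_member (sum_succ_le1 _ _).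
Qed.

End AfterLeader.

(** * Correctness *)

Lemma halts_atP i r v : halts_at (@leader_protocol V n t) inp tr i r v ->
  r = final_round /\ v = odflt (inp i) (leading (kn i r)).
Proof.
case=> hr hlt; have := next_action_halt i r.
move: hr; rewrite /next_action => hr; rewrite hr /= => /esym fr.
move: hr; rewrite /leader_protocol size_local_history fr => -[<-]; split=> //.
apply/eqP; rewrite eqn_leq fr andbT leqNgt; apply/negP => /hlt.
by rewrite next_action_halt leqnn.
Qed.

Lemma leader_protocol_correct :
  [/\ consensus (@leader_protocol V n t) inp B tr,
      time_at_most (@leader_protocol V n t) inp B tr final_round
    & messages_at_most B tr (100 * (t ^ 2 + n))].
Proof.
have [k0 k0B k0t] := correct_leader; have [v0 k0v] := leader_value k0.
have decided i v : i \notin B -> decides (@leader_protocol V n t) inp tr i v ->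
    leading (kn i final_round) = Some v /\ v = v0.
  move=> iB [r /halts_atP[-> ->]].
  by rewrite (leading_final k0B k0t k0v iB).
split=> [|i r v _ /halts_atP[-> _] //|R]; last exact: (messages_le k0B k0t k0v).
split.
- move=> i iB; exists (odflt (inp i) (leading (kn i final_round))), final_round.
  split=> [|s]; last by rewrite next_action_halt -ltnNge.
  by rewrite /next_action /leader_protocol size_local_history leqnn.
- by move=> i j v w iB jB /(decided _ _ iB)[_ ->] /(decided _ _ jB)[_ ->].
move=> i v iB /(decided _ _ iB)[li _]; split; last first.
  by apply: leading_claimed iB _; left; apply: li.
(* If [v] were nobody's input, two values would force all inputs to be equal, and unanimity would
   give that common input. *)
move=> two; have [/existsP[k /eqP <-]|] := boolP [exists k, inp k == v].
  by exists k.
rewrite negb_exists => /forallP inp_v; exists i.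
have inp_i k : inp k = inp i.
  by have := two (inp k) (inp i) v; rewrite (negPf (inp_v k)) (negPf (inp_v i)) !orbF => /eqP.
have h_gt0 := leq_ltn_trans (leq0n _) (height_final k0B k0t k0v iB).
have [k kB kK] := leading_voter (known_kn iB) h_gt0 li.
by rewrite (unanimous (v := inp i) _ kB kK).
Qed.

End Run.

Theorem theorem11 :
  exists (A : forall (V : eqType) (n t : nat), protocol V n) (C : nat),
    forall (V : eqType) (n t : nat), 2 * t < n ->
      respects_signatures (A V n t) /\
      forall (inp : 'I_n -> V) (B : {set 'I_n}) (tr : traffic V n),
        #|B| <= t -> execution (A V n t) inp B tr ->
        [/\ consensus (A V n t) inp B tr,
            time_at_most (A V n t) inp B tr (C * t.+1)
          & messages_at_most B tr (C * (t ^ 2 + n))].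
Proof.
(* The constant is that of the message bound; [8 * t + 16] rounds fit easily. *)
exists (fun V n t => @leader_protocol V n t), 100 => V n t tn.
split=> [|inp B tr Bt run]; first exact: leader_protocol_signatures.
have [cons time msgs] := leader_protocol_correct tn Bt run; split=> // i r v iB ir.
by apply: leq_trans (time i r v iB ir) _; rewrite final_roundE; lia.
Qed.
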